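(* Let $R$ be a unital commutative ring and $G$ a finite directed strongly connected graph with vertex set $V=[n]$, equipped with a product distance (integers $k_v\ge1$ and matrices $\eta(i,j)\in R^{k_i\times k_j}$ as in the context), with product distance matrix $D^*_G$ of size $K\times K$, $K=\sum_vk_v$. Let $G_j$ be the strong blocks of $G$ and $D^*_{G_j}$ the principal block submatrices of $D^*_G$ indexed by the nodes of $G_j$. Then $$\det(D^*_G)=\prod_j\det(D^*_{G_j}),\qquad \operatorname{cof}(D^*_G)=\sum_j\operatorname{cof}(D^*_{G_j})\prod_{i\ne j}\det(D^*_{G_i})-\det(D^*_G)\sum_{v\in V}k_v\big(\#\{j:v\in G_j\}-1\big).$$ If $D^*_G$ is invertible and $k_v=k$ for all cut-vertices $v$, then $\frac{\operatorname{cof}(D^*_G)}{\det(D^*_G)}-k=\sum_j\Big(\frac{\operatorname{cof}(D^*_{G_j})}{\det(D^*_{G_j})}-k\Big)$. If $D^*_{G_j}$ is invertible for all $j$, then $$(D^*_G)^{-1}=\sum_j\big[(D^*_{G_j})^{-1}\big]_j-\sum_{v\in V}\big(\#\{j:v\in G_j\}-1\big)[\mathrm{Id}_{k_v}]_v.$$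
   Context: A cut-vertex of $G$ is a vertex whose removal increases the number of connected components of the underlying undirected graph. The strong blocks of $G$ are the subgraphs induced on the blocks (maximal connected subgraphs without a cut-vertex of their own) of the underlying undirected graph. A product distance on $G$ is a choice of integers $k_1,\dots,k_n\ge1$ and matrices $\eta(i,j)\in R^{k_i\times k_j}$ such that (a) $\eta(v,v)=\mathrm{Id}_{k_v}$ for every cut-vertex $v$, and (b) if every directed path from $i$ to $j$ passes through the cut-vertex $v$, then $\eta(i,j)=\eta(i,v)\eta(v,j)$. The product distance matrix $D^*_G$ is the $K\times K$ block matrix with $(i,j)$ block $\eta(i,j)$. For a square matrix $A$, $\operatorname{cof}(A)$ is the sum of all its cofactors $(-1)^{i+j}\det A_{(i,j)}$ ($A_{(i,j)}$ = $A$ with row $i$ and column $j$ removed). $[A]_j$ denotes the $K\times K$ matrix having $A$ in the rows and columns corresponding to the nodes of $G_j$ and zeros elsewhere; $[\mathrm{Id}_{k_v}]_v$ similarly places $\mathrm{Id}_{k_v}$ in the rows/columns of node $v$. *)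

(* Defs.v *)
From mathcomp Require Export all_boot all_order all_algebra.

Set Implicit Arguments.
Unset Strict Implicit.
Unset Printing Implicit Defensive.

Import GRing.Theory.
Local Open Scope ring_scope.

(* Finite undirected graphs with nodes in T: H.1 is the node set and H.2 the
   set of edges, an edge being the two-element set of its ends.  Only pairs in
   which every edge is contained in H.1 (see subgraph) are graphs. *)
Notation ugraph T := ({set T} * {set {set T}})%type.

Section UndirectedGraphs.
Variable T : finType.
Implicit Types (G H : ugraph T) (v : T).

Definition adj H : rel T := [rel x y | [set x; y] \in H.2].

(* n_comp counts all the components because H.1 is closed under adj H and
   adj H is symmetric. *)
Definition num_components H : nat := n_comp (adj H) H.1.

Definition remove_vertex v H : ugraph T :=
  (H.1 :\ v, [set f in H.2 | v \notin f]).

Definition cut_vertex H v : bool :=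
  (v \in H.1) && (num_components H < num_components (remove_vertex v H))%N.

Definition connected H : bool :=
  (H.1 != set0) && [forall x in H.1, forall y in H.1, connect (adj H) x y].

Definition subgraph H G : bool :=
  [&& H.1 \subset G.1, H.2 \subset G.2 & [forall f in H.2, f \subset H.1]].

Definition connected_without_cut_vertex G H : bool :=
  [&& subgraph H G, connected H & [forall v, ~~ cut_vertex H v]].

Definition is_block G H : bool :=
  connected_without_cut_vertex G H &&
  [forall H' : ugraph T,
     connected_without_cut_vertex G H' && subgraph H H' ==> (H' == H)].

End UndirectedGraphs.

Section DirectedGraphs.
Variable n : nat.
Implicit Types (e : rel 'I_n) (i j v : 'I_n).

Definition strongly_connected e : Prop := forall i j, connect e i j.

Definition underlying e : ugraph 'I_n :=
  ([set: 'I_n],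
   [set [set p.1; p.2] | p : 'I_n * 'I_n & (p.1 != p.2) && e p.1 p.2]).

(* A strong block is the subgraph induced on the nodes of a block of the
   underlying graph; it is represented by that block B, its nodes being B.1. *)
Definition strong_blocks e : {set ugraph 'I_n} :=
  [set B | is_block (underlying e) B].

Definition num_blocks_at e v : nat := #|[set B in strong_blocks e | v \in B.1]|.

(* The path i :: p has no repeated vertex and contains its ends; for i = j the
   only one is the trivial path. *)
Definition all_paths_through e i j v : Prop :=
  forall p : seq 'I_n,
    path e i p -> uniq (i :: p) -> last i p = j -> v \in i :: p.

Definition product_distance (R : comPzRingType) e (k : 'I_n -> nat)
    (eta : forall i j, 'M[R]_(k i, k j)) : Prop :=
  [/\ forall v, (0 < k v)%N,
      forall v, cut_vertex (underlying e) v -> eta v v = 1%:M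
    & forall i j v, cut_vertex (underlying e) v ->
        all_paths_through e i j v -> eta i j = eta i v *m eta v j].

(* The indices, among the K = \sum_v k v rows (or columns), belonging to the
   nodes in W: tagnat.sig1 maps a row index to the node whose block it is in. *)
Definition node_indices (k : 'I_n -> nat) (W : {set 'I_n}) :
    {set 'I_(\sum_v k v)} :=
  [set a | tagnat.sig1 a \in W].

End DirectedGraphs.

Section Matrices.
Variable R : comPzRingType.

Definition cof m (A : 'M[R]_m) : R := \sum_i \sum_j cofactor A i j.

Definition principal_submx m (S : {set 'I_m}) (A : 'M[R]_m) : 'M[R]_#|S| :=
  mxsub enum_val enum_val A.

(* [A]_S, with the same (increasing) enumeration of S as in principal_submx. *)
Definition place m (S : {set 'I_m}) (A : 'M[R]_#|S|) : 'M[R]_m :=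
  \sum_a \sum_b A a b *: delta_mx (enum_val a) (enum_val b).

(* R is an arbitrary commutative ring, with no inverse operation, so inverses
   and quotients (which are unique) are expressed as relations. *)
Definition is_inverse_mx m (A B : 'M[R]_m) : Prop :=
  A *m B = 1%:M /\ B *m A = 1%:M.

Definition invertible_mx m (A : 'M[R]_m) : Prop := exists B, is_inverse_mx A B.

(* q = a / d, where d is invertible in R. *)
Definition is_quotient (a d q : R) : Prop := exists2 c, d * c = 1 & q = a * c.

End Matrices.

Section ProductDistanceMatrix.
Variables (R : comPzRingType) (n : nat) (k : 'I_n -> nat).
Variable eta : forall i j, 'M[R]_(k i, k j).

Definition distance_mx : 'M[R]_(\sum_v k v) :=
  \mxblock_(i < n, j < n) eta i j.

Definition block_distance_mx (B : ugraph 'I_n) :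
    'M[R]_#|node_indices k B.1| :=
  principal_submx (node_indices k B.1) distance_mx.

End ProductDistanceMatrix.

(* Main.v *)
Require Import Defs.
From HB Require Import structures.
From mathcomp Require Import ring.
Set Implicit Arguments.
Unset Strict Implicit.
Unset Printing Implicit Defensive.
Import GRing.Theory.

(** A cut-vertex v of a node set W splits it as W1 :|: W2 with
    W1 :&: W2 = {v}.  Padding the principal submatrix on S by the identity
    outside S gives a K x K matrix p_S with the same determinant, and on a
    product distance matrix the padded matrices satisfy
      p_W = (1 + w) p_W1 (1 - w) p_W2,
    where w is nilpotent.  Hence the determinants multiply and, as the adjugate
    is anti-multiplicative over any commutative ring,
      adj p_W - det p_W = det p_W2 (adj p_W1 - det p_W1)
                          + det p_W1 (adj p_W2 - det p_W2).
    Splitting until only blocks remain yields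
      adj D - det D = sum_B (prod_(C != B) det D_C) (adj p_B - det D_B),
    and summing entries, or dividing by det D, gives the formulas for cof and
    for the inverse.  All node sets W that occur are path-convex: a simple path
    between two nodes of W stays in W.  Therefore cut-vertices of W are
    cut-vertices of G, and W is a block when it has no cut-vertex. *)

(** * Blocks and cut-vertices *)

Section Components.
Variable T : finType.

Lemma setD1_notin (A : {set T}) (v : T) : v \notin A -> A :\ v = A.
Proof. by move=> vA; apply/setDidPl; rewrite disjoint_sym disjoints1. Qed.

Implicit Types (H : ugraph T) (v x y : T).

Lemma adj_sym H : symmetric (adj H).
Proof. by move=> x y; rewrite /adj /= setUC. Qed.

Lemma connect_adj_sym H : connect_sym (adj H).
Proof. exact/sym_connect_sym/adj_sym. Qed.

(** Unlike [connected], this holds for the empty graph, so deleting the only node of a graph does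
    not count as disconnecting it. *)
Definition pairwise_connected H :=
  [forall x in H.1, forall y in H.1, connect (adj H) x y].

Lemma pairwise_connectedP H :
  reflect {in H.1 &, forall x y, connect (adj H) x y} (pairwise_connected H).
Proof.
apply: (iffP forall_inP) => [cH x y xH yH|cH x xH].
  by have /forall_inP := cH x xH; apply.
by apply/forall_inP => y yH; apply: cH.
Qed.

Definition edges_inside H := [forall f in H.2, f \subset H.1].

Lemma adj_closed H : edges_inside H -> closed (adj H) H.1.
Proof.
move=> /forall_inP inH x y /inH /subsetP xyH.
by rewrite !xyH ?set21 ?set22.
Qed.

Lemma num_components_le1 H : edges_inside H ->
  (num_components H <= 1) = pairwise_connected H.
Proof.
move=> /adj_closed clH; have symH := connect_adj_sym H.
have rootH x : x \in H.1 -> fingraph.root (adj H) x \in H.1.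
  by rewrite (closed_connect clH (connect_root _ x)).
apply/idP/pairwise_connectedP => [/card_le1_eqP le1 x y xH yH|cH].
  apply/(fingraph.rootP symH); apply: le1.
    by rewrite inE /= roots_root //= rootH.
  by rewrite inE /= roots_root //= rootH.
apply/card_le1_eqP => x y; rewrite !inE /=.
case/andP=> /eqP rx xH /andP[/eqP ry yH]; rewrite -rx -ry.
by apply/(fingraph.rootP symH)/cH.
Qed.

Lemma num_components_gt0 H x : edges_inside H -> x \in H.1 ->
  0 < num_components H.
Proof.
move=> /adj_closed clH xH; apply/card_gt0P; exists (fingraph.root (adj H) x).
rewrite inE /= roots_root ?(closed_connect clH (connect_root _ x)) //.
  by rewrite -(closed_connect clH (connect_root _ x)).
exact: connect_adj_sym.
Qed.

Lemma remove_vertex_inside H v :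
  edges_inside H -> edges_inside (remove_vertex v H).
Proof.
move=> /forall_inP inH; apply/forall_inP=> f; rewrite inE => /andP[fH vf].
by rewrite subsetD1 vf inH.
Qed.

(** A connected graph has exactly one component, so a deletion increases the number exactly when it
    leaves two nodes disconnected. *)
Lemma cut_vertexE H v : edges_inside H -> connected H ->
  cut_vertex H v = (v \in H.1) && ~~ pairwise_connected (remove_vertex v H).
Proof.
move=> inH /andP[_ cH]; rewrite /cut_vertex; case vH: (v \in H.1) => //=.
rewrite -num_components_le1 ?remove_vertex_inside // -ltnNge.
suff -> : num_components H = 1 by [].
apply/eqP; rewrite eqn_leq num_components_le1 // (num_components_gt0 inH vH).
by rewrite andbT.
Qed.
End Components.

(** * Blocks as maximal nonseparable node sets *)

Section Blocks.
Variables (T : finType) (G : ugraph T).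
Hypothesis G1 : G.1 = setT.
Implicit Types (A B W C : {set T}) (H : ugraph T) (v x y : T).

Definition induced A : ugraph T := (A, [set f in G.2 | f \subset A]).

(** For [v] outside [A] the set [A :\ v] is [A] itself, so the quantifier may range over all
    nodes. *)
Definition nonseparable A :=
  [&& A != set0, pairwise_connected (induced A) &
      [forall v, pairwise_connected (induced (A :\ v))]].

Lemma adj_induced A x y :
  adj (induced A) x y = [&& adj G x y, x \in A & y \in A].
Proof. by rewrite /adj /= !inE subUset !sub1set. Qed.

Lemma remove_vertex_induced A v : remove_vertex v (induced A) = induced (A :\ v).
Proof.
congr pair; apply/setP=> f; rewrite !inE /= subsetD1.
by rewrite -!andbA.
Qed.

Lemma induced_inside A : edges_inside (induced A).
Proof. by apply/forall_inP=> f; rewrite inE => /andP[]. Qed.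

Lemma pairwise_connected_sub H A : H.1 = A -> subrel (adj H) (adj (induced A)) ->
  pairwise_connected H -> pairwise_connected (induced A).
Proof.
move=> <- subH /pairwise_connectedP cH; apply/pairwise_connectedP=> x y xH yH.
by apply: (connect_sub _ (cH x y xH yH)) => a b /subH /connect1.
Qed.

Lemma nonseparable_induced A :
  connected_without_cut_vertex G (induced A) = nonseparable A.
Proof.
rewrite /connected_without_cut_vertex /nonseparable /connected /=.
have -> : subgraph (induced A) G.
  rewrite /subgraph /= G1 subsetT /=; apply/andP; split.
    by apply/subsetP=> f; rewrite inE => /andP[].
  exact: induced_inside.
rewrite /= -andbA; case nA: (A != set0) => //=; case cA: pairwise_connected => //=.
  rewrite -/(pairwise_connected (induced A)) cA.
  have conA : connected (induced A) by rewrite /connected nA.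
  apply: eq_forallb => v; rewrite cut_vertexE ?induced_inside //=.
  rewrite negb_and negbK remove_vertex_induced.
  case vA: (v \in A) => //=; suff -> : A :\ v = A by rewrite cA.
  by rewrite setD1_notin ?vA.
by rewrite -/(pairwise_connected (induced A)) cA.
Qed.

(** Passing from [H] to the induced subgraph on its nodes only adds edges, which preserves
    connectedness, also after the deletion of a node. *)
Lemma without_cut_vertex_nonseparable H :
  connected_without_cut_vertex G H -> nonseparable H.1.
Proof.
case/and3P=> /and3P[_ /subsetP HG inH] conH /forallP ncut.
have [nH cH] := andP conH.
have subH : subrel (adj H) (adj (induced H.1)).
  move=> x y xy; rewrite adj_induced [adj G x y]HG //=.
  by have /subsetP xyH := forall_inP inH _ xy; rewrite !xyH ?set21 ?set22.
apply/and3P; split=> //; first exact: pairwise_connected_sub cH.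
apply/forallP=> v; have := ncut v; rewrite cut_vertexE // negb_and negbK.
have [vH|vH _] := boolP (v \in H.1); rewrite /=.
  apply: pairwise_connected_sub => //.
  rewrite -remove_vertex_induced => x y; rewrite /adj /= !inE.
  by case/andP=> /subH; rewrite /adj /= inE => ->.
have -> : H.1 :\ v = H.1 by rewrite setD1_notin.
exact: pairwise_connected_sub cH.
Qed.

(** The induced subgraph on the nodes of a block has no cut-vertex either, so by maximality it is
    the block itself. Blocks can hence be handled through their node sets. *)
Lemma blockP H : reflect
  [/\ H = induced H.1, nonseparable H.1 &
      forall A, nonseparable A -> H.1 \subset A -> A = H.1]
  (is_block G H).
Proof.
apply: (iffP andP) => [[cH /forallP maxH]|[defH nsH maxH]].
  have nsH := without_cut_vertex_nonseparable cH.
  have maxind A : nonseparable A -> H.1 \subset A -> induced A = H.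
    move=> nsA HA; apply/eqP; have /implyP := maxH (induced A); apply.
    rewrite nonseparable_induced nsA /=; apply/and3P; split=> //.
      case/and3P: cH => /and3P[_ /subsetP HG /forall_inP inH] _ _.
      apply/subsetP=> f fH; rewrite inE HG //=.
      by apply: subset_trans HA; apply: inH.
    by case/and3P: cH => /and3P[].
  by split=> // [|A nsA HA]; [rewrite maxind | rewrite -(maxind A)].
split; first by rewrite defH nonseparable_induced.
apply/forallP=> H'; apply/implyP=> /andP[cH' /and3P[sub1 sub2 _]].
have eq1 := maxH _ (without_cut_vertex_nonseparable cH') sub1.
rewrite defH -eq1; case: H' cH' sub1 sub2 eq1 => A E cH' /= sub1 sub2 eq1.
apply/eqP; congr pair; apply/eqP; rewrite eqEsubset.
case/and3P: cH' => /and3P[_ /subsetP /= HG /forall_inP /= inH] _ _.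
apply/andP; split; apply/subsetP=> f fE.
  by rewrite inE HG ?inH.
by apply: (subsetP sub2); rewrite defH -eq1.
Qed.
End Blocks.

(** * Path-convex node sets and induction along cut-vertices *)

Section BlockInduction.
Variables (T : finType) (G : ugraph T).
Hypothesis G1 : G.1 = setT.
Hypothesis connG : forall x y, connect (adj G) x y.
Implicit Types (A B W C : {set T}) (H : ugraph T) (v x y : T) (p : seq T).
Local Notation induced := (induced G).
Local Notation nonseparable := (nonseparable G).

Definition path_convex W := forall x p, path (adj G) x p -> uniq (x :: p) ->
  x \in W -> last x p \in W -> {subset p <= W}.

(** Satisfied by every union [C] of components of [W :\ v]: inside [W], only [v] leads out of it. *)
Definition exits_through W C v :=
  forall x y, x \in C -> y \in W -> adj G x y -> (y \in C) || (y == v).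

Lemma exit_path W C v x p : exits_through W C v -> x \in C ->
  path (adj G) x p -> {subset p <= W} -> last x p \notin C -> v \in p.
Proof.
move=> exC; elim: p x => [x ->|y p IHp x xC] //= /andP[xy yp] pW lC.
rewrite inE; case: eqVneq => //= nvy; apply: IHp yp _ lC.
  have := exC x y xC (pW y (mem_head _ _)) xy.
  by rewrite [y == v]eq_sym (negbTE nvy) orbF.
by move=> z zp; apply: pW; rewrite inE zp orbT.
Qed.

Lemma path_induced A x p : x \in A ->
  path (adj (induced A)) x p = path (adj G) x p && all (mem A) p.
Proof.
elim: p x => //= y p IHp x xA; rewrite adj_induced xA /=.
case: (adj G x y) => //=; case yA: (y \in A) => /=; last by rewrite andbF.
exact: IHp.
Qed.

Lemma path_convex_connected W : path_convex W -> pairwise_connected (induced W).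
Proof.
move=> cvW; apply/pairwise_connectedP=> x y /= xW yW.
case/connectP: (connG x y) yW => p /shortenP[q qG uq _ -> lW].
apply/connectP; exists q => //; rewrite path_induced // qG /=.
by apply/allP; apply: cvW qG uq xW lW.
Qed.

(** A simple path between nodes of [v |: C] that met [C'] would have to pass through [v] both before
    and after that visit. *)
Lemma path_convex_half W C C' v : path_convex W ->
    W = v |: (C :|: C') -> v \notin C' -> [disjoint C & C'] ->
    exits_through W C v -> exits_through W C' v ->
  path_convex (v |: C).
Proof.
move=> cvW defW vC' dCC' exC exC' x p px up xC lC.
have sCW : {subset v |: C <= W}.
  by apply/subsetP; rewrite defW setUA subsetUl.
have pW := cvW x p px up (sCW _ xC) (sCW _ lC).
have nC' z : z \in v |: C -> z \notin C'.
  case/setU1P=> [-> //|zC]; apply: contraL dCC' => zC'.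
  by apply/pred0Pn; exists z; rewrite /= zC.
move=> z zp; apply: contraT => zNC.
have zC' : z \in C'.
  by have := pW z zp; rewrite defW setUA inE (negbTE zNC).
case/splitPr: zp px up lC pW => p1 p2.
rewrite cat_path last_cat /= => /and3P[px1 xz zp2] up lC pW.
have vp2 : v \in p2.
  apply: (exit_path exC' zC' zp2) (nC' _ lC) => y yp2.
  by apply: pW; rewrite mem_cat inE yp2 !orbT.
have vp1 : v \in x :: p1.
  rewrite inE; case: eqVneq => //= nvx.
  have xC0 : x \in C by case/setU1P: xC => // xv; rewrite xv eqxx in nvx.
  have: v \in rcons p1 z.
    apply: (exit_path exC xC0); first by rewrite rcons_path px1.
      by move=> y; rewrite mem_rcons inE => yp; apply: pW;
         rewrite mem_cat inE; case/predU1P: yp => [->|->]; rewrite ?eqxx ?orbT.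
    rewrite last_rcons; apply: contraL dCC' => zC.
    by apply/pred0Pn; exists z; rewrite /= zC.
  rewrite mem_rcons inE => /predU1P[vz|//].
  by rewrite vz zC' in vC'.
have: uniq ((x :: p1) ++ z :: p2) by [].
rewrite cat_uniq => /and3P[_ /hasPn nup _].
by have := nup v; rewrite inE vp2 orbT => /(_ isT); rewrite /= vp1.
Qed.

Definition blocks_inside W : {set ugraph T} :=
  [set B | is_block G B & B.1 \subset W].

(** Follow a path inside [A] from [z] up to its first node in [W]: each edge used has an end outside
    [W]. *)
Lemma connect_outside W A z w : pairwise_connected (induced A) ->
    z \in A -> z \notin W -> w \in A -> w \in W ->
  exists2 a, a \in A :&: W &
    connect [rel x y | adj G x y && ~~ ((x \in W) && (y \in W))] z a.
Proof.
move=> /pairwise_connectedP cA zA zW wA wW.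
case/connectP: (cA z w zA wA) => p; rewrite path_induced //.
elim: p z zA zW => [|y p IHp] /= z zA zW.
  by move=> _ wz; rewrite -wz wW in zW.
case/andP=> /andP[zy yp] /andP[yA pA] lw.
have out_zy : connect [rel x y | adj G x y && ~~ ((x \in W) && (y \in W))] z y.
  by apply: connect1; rewrite /= zy (negbTE zW).
have [yW|yW] := boolP (y \in W); first by exists y; rewrite // inE yA.
have [|a aAW ya] := IHp y yA yW _ lw; first by rewrite yp.
by exists a => //; apply: connect_trans ya.
Qed.

(** If a larger nonseparable [A] had a node [z] outside [W], two routes from [z] would reach [W] at
    distinct nodes [a1] and [a2]; joining them would give a simple path between nodes of [W] that
    leaves [W], against convexity. The size condition provides a target in [W] other than [a1]. *)
Lemma path_convex_block W : path_convex W -> nonseparable W ->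
  1 < #|W| \/ W = setT -> is_block G (induced W).
Proof.
move=> cvW nsW bigW; apply/(blockP G1); split=> //= A nsA WA.
case: bigW => [W2|WT]; last first.
  by apply/eqP; rewrite eqEsubset WA WT subsetT.
apply/eqP; rewrite eqEsubset WA andbT; apply/subsetP=> z zA.
apply: contraT => zW; case/and3P: nsA => _ cA /forallP cA1.
have [w wW] : exists w, w \in W by apply/card_gt0P; apply: ltnW.
have [a1 /setIP[a1A a1W] za1] :=
  connect_outside cA zA zW (subsetP WA w wW) wW.
have [w' w'W w'a1] : exists2 w', w' \in W & w' != a1.
  have : 0 < #|W :\ a1| by rewrite (cardsD1 a1 W) a1W in W2.
  by case/card_gt0P=> w'; rewrite !inE => /andP[? ?]; exists w'.
have za1n : z != a1 by apply: contraNneq zW => ->.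
(* Connectedness of [A :\ a1] yields a second entry point into [W], different from [a1]. *)
have [||a2 /setIP[/setD1P[a21 _] a2W] za2] :=
    connect_outside (w := w') (cA1 a1) _ zW _ w'W.
- by rewrite !inE za1n.
- by rewrite !inE w'a1 (subsetP WA).
have sym_out : connect_sym
    [rel x y | adj G x y && ~~ ((x \in W) && (y \in W))].
  by apply: sym_connect_sym => x y /=; rewrite adj_sym [(x \in W) && _]andbC.
move: za1; rewrite sym_out => /connect_trans/(_ za2) /connectP[p].
case/shortenP=> q; case: q => [_ _ _ /= a2E|y q qp uq _ a2E].
  by rewrite a2E eqxx in a21.
have qG : path (adj G) a1 (y :: q) by apply: sub_path qp => b c /andP[].
have qW := cvW a1 (y :: q) qG uq a1W.
case/andP: qp => /andP[_]; rewrite a1W /= => yW.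
by rewrite qW ?mem_head // -a2E in yW.
Qed.

Hypothesis loopless : forall x, ~~ adj G x x.

(** A neighbour [z] of [v] makes [[set v; z]] nonseparable, so [[set v]] is not maximal. *)
Lemma block_not_singleton H v x : is_block G H -> x != v -> ~~ (H.1 \subset [set v]).
Proof.
move=> /(blockP G1)[_ nsH maxH] nxv; apply/negP=> Hv.
have vH : H.1 = [set v].
  apply/eqP; move: Hv; rewrite subset1 => /orP[//|/eqP H0].
  by case/and3P: nsH; rewrite H0 eqxx.
have [z vz] : exists z, adj G v z.
  case/connectP: (connG v x) => -[_ xv|z p /= /andP[vz _] _]; last by exists z.
  by rewrite xv eqxx in nxv.
have zv : z != v by apply: contraTneq vz => ->.
have con1 A u : A \subset [set u] -> pairwise_connected (induced A).
  move=> /subsetP Au; apply/pairwise_connectedP=> a b /Au /set1P-> /Au /set1P->.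
  exact: connect0.
suff ns2 : nonseparable [set v; z].
  have := maxH _ ns2; rewrite vH => /(_ (subsetUl _ _)) /setP/(_ z).
  by rewrite !inE eqxx orbT (negbTE zv).
have c2 : pairwise_connected (induced [set v; z]).
  have cvz : connect (adj (induced [set v; z])) v z.
    by apply: connect1; rewrite adj_induced vz set21 set22.
  apply/pairwise_connectedP=> a b /set2P[]-> /set2P[]->; rewrite ?connect0 //.
  by rewrite connect_adj_sym.
apply/and3P; split=> //; first by apply/set0Pn; exists v; rewrite set21.
apply/forallP=> u; have [->|nuv] := eqVneq u v.
  by apply: (con1 _ z); apply/subsetP=> a; rewrite !inE; case: (a == v).
have [->|nuz] := eqVneq u z.
  by apply: (con1 _ v); apply/subsetP=> a; rewrite !inE orbC; case: (a == z).
by rewrite setD1_notin // !inE negb_or nuv.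
Qed.

(** A block minus [v] is connected and so cannot have nodes in both [C] and [C']. A block inside
    both halves would be contained in [[set v]], which [block_not_singleton] excludes. *)
Lemma blocks_inside_split W C C' v :
    W = v |: (C :|: C') -> v \notin C' -> C != set0 -> v \notin C ->
    [disjoint C & C'] -> exits_through W C v ->
  blocks_inside W = blocks_inside (v |: C) :|: blocks_inside (v |: C') /\
  [disjoint blocks_inside (v |: C) & blocks_inside (v |: C')].
Proof.
move=> defW vC' /set0Pn[x xC] vC dCC' exC; split.
  apply/setP=> H; rewrite !inE -andb_orr.
  have [blH|//] := boolP (is_block G H); rewrite /=.
  apply/idP/orP => [HW|[] HC]; last 2 first.
  - by apply: subset_trans HC _; rewrite defW setUA subsetUl.
  - by apply: subset_trans HC _; rewrite defW setUS // subsetUr.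
  have [sub|/subsetPn[c' c'H c'C]] := boolP (H.1 \subset v |: C); first by left.
  right; apply/subsetP=> c cH; apply: contraT => cC'.
  case/blockP: blH => // _ /and3P[_ _ /forallP/(_ v)/pairwise_connectedP cHv] _.
  have [cv c'v] : c != v /\ c' != v.
    by move: c'C cC'; rewrite !inE !negb_or => /andP[-> _] /andP[-> _].
  have cC : c \in C.
    have := subsetP HW c cH; move: cC'; rewrite defW !inE !negb_or.
    by case/andP=> /negbTE-> /negbTE->; rewrite orbF.
  have c'NC : c' \notin C by move: c'C; rewrite !inE negb_or => /andP[].
  have cD : c \in H.1 :\ v by rewrite !inE cv.
  have /connectP[p] : connect (adj (induced (H.1 :\ v))) c c'.
    by apply: cHv; rewrite // !inE c'v.
  rewrite path_induced // => /andP[cp /allP pH] lc'.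
  have: v \in p.
    apply: (exit_path exC cC cp) => [y /pH /setD1P[_ /(subsetP HW)] //|].
    by rewrite -lc'.
  by move/pH; rewrite /= !inE eqxx.
rewrite disjoints_subset; apply/subsetP=> H; rewrite !inE => /andP[blH HC].
rewrite blH /=; apply/negP=> HC'; have xv : x != v by apply: contraTneq xC => ->.
case/negP: (block_not_singleton blH xv); apply/subsetP=> z zH.
have := subsetP HC z zH; have := subsetP HC' z zH; rewrite !inE.
case: eqP => //= _ zC' zC; apply: contraTT dCC' => _.
by apply/pred0Pn; exists z; rewrite /= zC.
Qed.

(** Restricted to simple paths, like [all_paths_through], since path-convexity controls only
    those. *)
Definition separates v A B := forall x p, path (adj G) x p -> uniq (x :: p) ->
  x \in A -> last x p \in B -> v \in x :: p.

Lemma separates_halves W C C' v : path_convex W -> W = v |: (C :|: C') ->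
  v \notin C' -> [disjoint C & C'] -> exits_through W C v ->
  separates v (v |: C) (v |: C').
Proof.
move=> cvW defW vC' dCC' exC x p px up xC lC'.
have sCW : {subset v |: C <= W}.
  by apply/subsetP; rewrite defW setUA subsetUl.
have sCW' : {subset v |: C' <= W}.
  by apply/subsetP; rewrite defW setUS // subsetUr.
have pW := cvW x p px up (sCW _ xC) (sCW' _ lC').
case/setU1P: xC => [->|xC]; first by rewrite mem_head.
case/setU1P: lC' => [<-|lC']; first exact: mem_last.
rewrite inE (exit_path exC xC px pW) ?orbT //.
apply: contraL dCC' => lC.
by apply/pred0Pn; exists (last x p); rewrite /= lC.
Qed.

(** If the deletion of [v] left [x] and [y] connected, shortening a path between them would give a
    simple path of [G] that avoids [v]. *)
Lemma separates_cut_vertex v x y A B : separates v A B -> x \in A -> y \in B ->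
  x != v -> y != v -> cut_vertex G v.
Proof.
move=> sepAB xA yB xv yv.
have inG : edges_inside G by apply/forall_inP=> f _; rewrite G1 subsetT.
have conG : connected G.
  apply/andP; split; first by apply/set0Pn; exists x; rewrite G1.
  by apply/pairwise_connectedP.
rewrite cut_vertexE // G1 inE /=; apply/negP=> /pairwise_connectedP cGv.
have /connectP[p] : connect (adj (remove_vertex v G)) x y.
  by apply: cGv; rewrite /= G1 !inE ?xv ?yv.
case/shortenP=> q qGv uq _ lq.
have adjGv z z' : adj (remove_vertex v G) z z' -> adj G z z' && (z' != v).
  rewrite /adj /= !inE negb_or => /and3P[-> _].
  by rewrite eq_sym.
have qG : path (adj G) x q by apply: sub_path qGv => z z' /adjGv /andP[].
have: v \in x :: q by apply: (sepAB x q); rewrite -?lq.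
rewrite inE eq_sym (negbTE xv) /= => vq.
move: {uq lq qG} qGv vq; elim: q x {xA xv} => //= z q IHq x /andP[/adjGv/andP[_ zv] zq].
by rewrite inE eq_sym (negbTE zv); apply: IHq zq.
Qed.

(** Induction on the size of a path-convex [W]. A nonseparable [W] is a block; otherwise the
    deletion of some [v] disconnects it, and one component with [v] and the rest with [v] are
    smaller path-convex sets meeting in [v]. The predicate carries the set of blocks so that sums
    and products over blocks can be split. *)
Lemma block_ind (P : {set T} -> {set ugraph T} -> Prop) :
    (forall H, is_block G H -> P H.1 [set H]) ->
    (forall v W1 W2 (b1 b2 : {set ugraph T}), cut_vertex G v ->
       W1 :&: W2 = [set v] -> separates v W1 W2 -> separates v W2 W1 ->
       [disjoint b1 & b2] -> P W1 b1 -> P W2 b2 -> P (W1 :|: W2) (b1 :|: b2)) ->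
    T ->
  P setT [set H | is_block G H].
Proof.
move=> Pblock Pglue x0.
have -> : [set H | is_block G H] = blocks_inside setT.
  by apply/setP=> H; rewrite !inE subsetT andbT.
(* The condition [1 < #|W| \/ W = setT] excludes single nodes of a larger graph, which are not
   blocks. *)
suff indW k W : #|W| < k -> path_convex W -> W != set0 ->
    1 < #|W| \/ W = setT -> P W (blocks_inside W).
  apply: (indW #|[set: T]|.+1) => //; last by right.
    by move=> x p _ _ _ _ y _; rewrite inE.
  by apply/set0Pn; exists x0.
elim: k W => // k IHk W ltWk cvW W0 bigW.
have [nsW|] := boolP (nonseparable W).
  have blW := path_convex_block cvW nsW bigW.
  suff -> : blocks_inside W = [set induced W] by apply: (Pblock _ blW).
  apply/setP=> H; rewrite !inE; apply/andP/eqP=> [[blH HW]|->]; last by [].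
  by case/(blockP G1): blH => HE _ maxH; rewrite (maxH W nsW HW) -HE.
rewrite /nonseparable W0 path_convex_connected //=.
case/forallPn=> v; rewrite /pairwise_connected; case/forall_inPn=> x /= xWv.
case/forall_inPn=> y yWv nxy.
have [/setD1P[xv xW] /setD1P[yv yW]] := (xWv, yWv).
(* Deleting a node outside [W] would leave the connected set [W] unchanged. *)
have vW : v \in W.
  apply: contraNT nxy => vW; rewrite setD1_notin //.
  by have /pairwise_connectedP := path_convex_connected cvW; apply.
set r := adj (induced (W :\ v)) in nxy.
(* [C] is the component of [x] in [W :\ v], and [C'], which contains [y], collects the others. *)
pose C := [set z in W :\ v | connect r x z]; pose C' := (W :\ v) :\: C.
have xC : x \in C by rewrite inE xWv connect0.
have yC' : y \in C' by rewrite inE yWv inE yWv /= nxy.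
have vC : v \notin C by rewrite !inE eqxx.
have vC' : v \notin C' by rewrite !inE eqxx andbF.
have CWv : C \subset W :\ v by apply/subsetP=> z; rewrite inE => /andP[].
have defW : W = v |: (C :|: C').
  by rewrite /C' -{1}(setD1K vW) -{1}(setID (W :\ v) C) (setIidPr CWv).
have dCC' : [disjoint C & C'].
  by rewrite disjoint_sym disjoints_subset /C' setDE subsetIr.
have exC : exits_through W C v.
  move=> a b aC bW ab; case: eqVneq => [//|bv] /=; rewrite ?orbT // orbF.
  move: aC; rewrite inE => /andP[aW xa]; rewrite !inE bv bW /=.
  by apply: connect_trans xa (connect1 _); rewrite /r adj_induced ab aW !inE bv.
have exC' : exits_through W C' v.
  move=> a b aC' bW ab; case: eqVneq => [//|bv] /=; rewrite ?orbT // orbF.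
  rewrite inE !inE bv bW /= andbT; apply: contraTN aC' => xb.
  rewrite !inE negb_and negbK; apply/orP.
  have [->|av] := eqVneq a v; first by right.
  have [aW|aW] := boolP (a \in W); last by right.
  left=> /=; apply: connect_trans xb (connect1 _).
  by rewrite /r adj_induced adj_sym ab !inE bv av bW.
have defW' : W = v |: (C' :|: C) by rewrite [C' :|: C]setUC.
have dC'C : [disjoint C' & C] by rewrite disjoint_sym.
have C0 : C != set0 by apply/set0Pn; exists x.
have [-> dis] := blocks_inside_split defW vC' C0 vC dCC' exC.
have cv1 := path_convex_half cvW defW vC' dCC' exC exC'.
have cv2 := path_convex_half cvW defW' vC dC'C exC' exC.
have sep1 := separates_halves cvW defW vC' dCC' exC.
have sep2 := separates_halves cvW defW' vC dC'C exC'.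
have -> : W = (v |: C) :|: (v |: C') by rewrite {1}defW setUUr.
have size_half A z : A \subset W -> z \in W -> z \notin A -> #|A| < k.
  move=> AW zW zA; rewrite -ltnS; apply: leq_trans ltWk.
  rewrite ltnS; apply: proper_card; apply/properP; split=> //.
  by exists z.
have gt1 A z : z \in A -> v \notin A -> 1 < #|v |: A|.
  by move=> zA vA; rewrite cardsU1 vA (cardsD1 z) zA.
apply: (Pglue v) => //.
- exact: (separates_cut_vertex sep1 (setU1r _ xC) (setU1r _ yC') xv yv).
- apply/setP=> z; rewrite !inE; case: eqVneq => //= zv.
  by case: (z \in W); case: connect.
- apply: IHk => //; last 2 first.
  + by apply/set0Pn; exists v; rewrite setU11.
  + by left; apply: gt1 xC vC.
  apply: (size_half _ y) => //; first by rewrite defW setUA subsetUl.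
  by rewrite inE negb_or inE yv; case/setDP: yC'.
- apply: IHk => //; last 2 first.
  + by apply/set0Pn; exists v; rewrite setU11.
  + by left; apply: gt1 yC' vC'.
  apply: (size_half _ x) => //; first by rewrite defW setUS // subsetUr.
  by rewrite !inE negb_or xv xW connect0.
Qed.
End BlockInduction.

Local Open Scope ring_scope.

(** * Determinants and adjugates over commutative rings *)

(* Identities between adjugates are proved for the characteristic matrix of - A,
   whose determinant is monic, hence regular, and then specialized at 'X = 0,
   where that matrix becomes A. *)
Section GenericMatrix.
Variable R : comNzRingType.
Let ev0 : {rmorphism {poly R} -> R} := horner_eval (0 : R).

Let ev0_char_poly_mx m (A : 'M[R]_m) :
  map_mx ev0 (char_poly_mx (- A)) = A.
Proof.
by apply/matrixP=> i j; rewrite !mxE /= horner_evalE !hornerE hornerMn hornerX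
  mul0rn sub0r opprK.
Qed.

Let ev0_polyC m p (A : 'M[R]_(m, p)) : map_mx ev0 (map_mx polyC A) = A.
Proof. by apply/matrixP=> i j; rewrite !mxE /= horner_evalE hornerC. Qed.

Let char_lreg m (A : 'M[R]_m) : GRing.lreg (\det (char_poly_mx A)).
Proof. exact/monic_lreg/char_poly_monic. Qed.

Lemma adj_mulmx_nz m (A B : 'M[R]_m) : \adj (A *m B) = \adj B *m \adj A.
Proof.
have lregZ (c : {poly R}) (M N : 'M_m) : GRing.lreg c -> c *: M = c *: N -> M = N.
  move=> creg /matrixP eqMN; apply/matrixP=> i j; apply: creg.
  by have := eqMN i j; rewrite !mxE.
rewrite -{1}(ev0_char_poly_mx A) -{1}(ev0_char_poly_mx B) -map_mxM -map_mx_adj.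
rewrite -{2}(ev0_char_poly_mx A) -{2}(ev0_char_poly_mx B) -!map_mx_adj -map_mxM.
congr map_mx; move: (@char_lreg _ (- A)) (@char_lreg _ (- B)).
move: (char_poly_mx (- A)) (char_poly_mx (- B)) => X Y regX regY.
apply: (lregZ (\det (X *m Y))); first by rewrite det_mulmx; apply: lregM.
(* Both sides of the claim, multiplied by [X *m Y], give its determinant, which is regular and can
   be cancelled. *)
have XYadj : X *m Y *m (\adj Y *m \adj X) = (\det (X *m Y))%:M.
  rewrite mulmxA -(mulmxA X) mul_mx_adj mul_mx_scalar -scalemxAl mul_mx_adj.
  by rewrite scale_scalar_mx mulrC -det_mulmx.
by rewrite -[LHS]mul_mx_scalar -XYadj mulmxA mul_adj_mx mul_scalar_mx.
Qed.

(** This is the matrix determinant lemma, with the adjugate replacing determinant times inverse.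
    Both sides are the determinant of the bordered matrix with blocks [M], [p], [- r], [1]. *)
Lemma det_rank1_update_nz m (M : 'M[R]_m) (p : 'cV_m) (r : 'rV_m) :
  \det (M + p *m r) = \det M + (r *m \adj M *m p) 0 0.
Proof.
have -> : \det (M + p *m r) = \det (block_mx M p (- r) 1%:M).
  rewrite (_ : block_mx _ _ _ _ =
    block_mx 1%:M p 0 1%:M *m block_mx (M + p *m r) 0 (- r) 1%:M).
    by rewrite det_mulmx det_ublock det_lblock !det1 !mul1r mulr1.
  by rewrite mulmx_block !mul1mx !mulmx1 !mul0mx !add0r mulmxN addrK.
pose X := char_poly_mx (- M); pose q := map_mx polyC p; pose s := map_mx polyC r.
have : \det (block_mx X q (- s) 1%:M) = \det X + (s *m \adj X *m q) 0 0.
  apply: (@char_lreg _ (- M)); rewrite -/X mulrC; set d := \det X.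
  (* This column operation clears [q] without inverting [X]; it costs the factor [d], which is
     regular. *)
  have {1}<- : \det (block_mx 1%:M (- (\adj X *m q)) 0 d%:M : 'M_(m + 1)) = d.
    by rewrite det_ublock det1 mul1r det_scalar1.
  rewrite -det_mulmx mulmx_block !mulmx1 !mulmx0 !addr0 mulmxN mulmxA mul_mx_adj.
  rewrite mul_mx_scalar mul_scalar_mx addNr mulmxN mulNmx opprK mul1mx det_lblock.
  by rewrite mulmxA [_ + d%:M]addrC det_mx11 [in LHS]mxE; congr (_ * (_ + _)); rewrite mxE.
move/(congr1 ev0); rewrite rmorphD -!det_map_mx map_block_mx map_mxN map_mx1.
rewrite ev0_char_poly_mx !ev0_polyC => ->; congr (_ + _).
have -> : r *m \adj M *m p = map_mx ev0 (s *m \adj X *m q).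
  by rewrite !map_mxM map_mx_adj ev0_char_poly_mx !ev0_polyC.
by rewrite [RHS]mxE.
Qed.
End GenericMatrix.


(* {poly R} is only defined over a nontrivial ring R. *)
Lemma comPzRing_ind (P : comPzRingType -> Prop) :
    (forall R : comPzRingType, (forall x y : R, x = y) -> P R) ->
    (forall R : comNzRingType, P R) ->
  forall R, P R.
Proof.
move=> P0 P1 R; have [R0|R1] := eqVneq (1 : R) 0.
  by apply: P0 => x y; rewrite -[x]mulr1 -[y]mulr1 R0 !mulr0.
case: R R1 => T [c1 c2 c3 c4 c5 c6 c7 c8 c9 c10 c11] R1.
(* The structures of [R] are repacked together with [1 != 0], so that statements about [S] are
   statements about [R]. *)
pose S : comNzRingType :=
  HB.pack T c1 c2 c3 c4 c5 c6 c7 c8 c9 c10 c11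
    (GRing.PzSemiRing_isNonZero.Build _ R1).
exact: (P1 S).
Qed.

Section CommutativeMatrix.
Variable R : comPzRingType.

Lemma adj_mulmx m (A B : 'M[R]_m) : \adj (A *m B) = \adj B *m \adj A.
Proof.
move: A B; apply: (comPzRing_ind (P := fun R => forall A B : 'M[R]_m,
  \adj (A *m B) = \adj B *m \adj A)).
  by move=> S R0 A B; apply/matrixP=> i j; apply: R0.
by move=> S; exact: (@adj_mulmx_nz S m).
Qed.

Lemma det_rank1_update m (M : 'M[R]_m) (p : 'cV_m) (r : 'rV_m) :
  \det (M + p *m r) = \det M + (r *m \adj M *m p) 0 0.
Proof.
move: M p r; apply: (comPzRing_ind
  (P := fun R => forall (M : 'M[R]_m) (p : 'cV_m) (r : 'rV_m),
    \det (M + p *m r) = \det M + (r *m \adj M *m p) 0 0)).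
  by move=> S R0 *; apply: R0.
by move=> S; exact: (@det_rank1_update_nz S m).
Qed.

(** Sylvester's determinant identity: both sides are the determinant of the matrix with blocks [1],
    [U], [- V], [1], eliminated in two ways. *)
Lemma det_mulmxC_add1 m p (U : 'M[R]_(m, p)) (V : 'M[R]_(p, m)) :
  \det (1%:M + U *m V) = \det (1%:M + V *m U).
Proof.
transitivity (\det (block_mx 1%:M U (- V) 1%:M)).
  rewrite (_ : block_mx _ _ _ _ =
    block_mx 1%:M U 0 1%:M *m block_mx (1%:M + U *m V) 0 (- V) 1%:M).
    by rewrite det_mulmx det_ublock det_lblock !det1 !mul1r mulr1.
  by rewrite mulmx_block !mul1mx !mulmx1 !mul0mx !add0r mulmxN addrK.
rewrite (_ : block_mx _ _ _ _ =
  block_mx 1%:M 0 (- V) 1%:M *m block_mx 1%:M U 0 (1%:M + V *m U)).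
  by rewrite det_mulmx det_ublock det_lblock !det1 !mul1r.
rewrite mulmx_block !mul1mx !mulmx1 !mul0mx !addr0 mulNmx.
by rewrite addrCA addNr addr0.
Qed.
End CommutativeMatrix.

(** * Padded principal submatrices *)

Section Padding.
Variables (R : comPzRingType) (m : nat).
Implicit Types (A D : 'M[R]_m) (S T : {set 'I_m}).

Definition restr_id S : 'M[R]_m := diag_mx (\row_i (i \in S)%:R).
Definition padmx S A : 'M[R]_m :=
  restr_id S *m A *m restr_id S + (1%:M - restr_id S).

Lemma restr_idE S i j : restr_id S i j = ((i == j) && (i \in S))%:R.
Proof. by rewrite !mxE; case: eqP => [->|]; rewrite ?mulr1n. Qed.

Lemma mul_restr_idE S A i j : (restr_id S *m A) i j = (i \in S)%:R * A i j.
Proof. by rewrite mul_diag_mx !mxE. Qed.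

Lemma mul_mx_restr_idE S A i j : (A *m restr_id S) i j = A i j * (j \in S)%:R.
Proof. by rewrite mul_mx_diag !mxE. Qed.

Lemma mul_restr_id S T : restr_id S *m restr_id T = restr_id (S :&: T).
Proof.
apply/matrixP=> i j; rewrite mul_restr_idE !restr_idE inE.
by case: (i == j); case: (i \in S); case: (i \in T); rewrite ?(mul0r, mul1r).
Qed.

Lemma restr_idU S T :
  restr_id (S :|: T) = restr_id S + restr_id T - restr_id (S :&: T).
Proof.
have addE (A B C : 'M[R]_m) i j : (A + B - C) i j = A i j + B i j - C i j.
  by rewrite !mxE.
apply/matrixP=> i j; rewrite addE !restr_idE !inE.
by case: (i == j); case: (i \in S); case: (i \in T); rewrite /=; ring.
Qed.

Lemma restr_idT : restr_id setT = 1%:M.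
Proof. by apply/matrixP=> i j; rewrite restr_idE inE andbT mxE. Qed.

(* s, t and p stand for the idempotents of S, T and S :&: T. *)
Section Glue.
Variables (D s t p : 'M[R]_m).
Hypotheses (ss : s *m s = s) (tt : t *m t = t).
Hypotheses (st : s *m t = p) (ts : t *m s = p).
Hypothesis pDp : p *m D *m p = p.
Hypothesis sDt : s *m D *m t = s *m D *m p *m D *m t.
Hypothesis tDs : t *m D *m s = t *m D *m p *m D *m s.

Let pad (x : 'M[R]_m) := x *m D *m x + (1%:M - x).
Variable w : 'M[R]_m.
Hypothesis w_def : w = (t - p) *m D *m p.

Let sp : s *m p = p. Proof. by rewrite -st mulmxA ss. Qed.
Let ps : p *m s = p. Proof. by rewrite -ts -mulmxA ss. Qed.
Let tp : t *m p = p. Proof. by rewrite -ts mulmxA tt. Qed.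
Let pt : p *m t = p. Proof. by rewrite -st -mulmxA tt. Qed.
Let pp : p *m p = p. Proof. by rewrite -{1}st -mulmxA tp sp. Qed.
Let ptp : p *m (t - p) = 0. Proof. by rewrite mulmxBr pt pp subrr. Qed.
Let stp : s *m (t - p) = 0. Proof. by rewrite mulmxBr st sp subrr. Qed.
Let tps : (t - p) *m s = 0. Proof. by rewrite mulmxBl ts ps subrr. Qed.
Let tsp : t *m (s - p) = 0. Proof. by rewrite mulmxBr ts tp subrr. Qed.
Let sw : s *m w = 0. Proof. by rewrite w_def !mulmxA stp !mul0mx. Qed.
Let wp : w *m p = w. Proof. by rewrite w_def -!mulmxA pp. Qed.
Let ws : w *m s = w. Proof. by rewrite w_def -!mulmxA ps. Qed.
Let wt : w *m t = w. Proof. by rewrite w_def -!mulmxA pt. Qed.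
Let pw : p *m w = 0. Proof. by rewrite w_def !mulmxA ptp !mul0mx. Qed.
Let ww : w *m w = 0. Proof. by rewrite -{1}wp -mulmxA pw mulmx0. Qed.
(** On the columns of [s], multiplying [D] by [w] yields its rows in [t - p]; the separation [tDs]
    enters here. *)
Let wDs : w *m D *m s = t *m D *m s - p *m D *m s.
Proof. by rewrite w_def !mulmxBl -tDs pDp. Qed.
Let wDp : w *m D *m p = t *m D *m p - p.
Proof. by rewrite w_def -(mulmxA _ D p) -(mulmxA _ p) (mulmxA p) pDp !mulmxBl pDp. Qed.

(** Block elimination: [1%:M - w] clears the columns of [p] in the rows of [t - p], [pad s] fills in
    the rows of [s] by [sDt], and [1%:M + w] restores the cleared rows by [tDs]. *)
Lemma glue_pad_factor :
  pad (s + t - p) = (1%:M + w) *m (pad s *m ((1%:M - w) *m pad t)).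
Proof.
have wpad : w *m pad t = w *m D *m t.
  by rewrite /pad mulmxDr !mulmxA wt mulmxBr mulmx1 wt subrr addr0.
have E1 : (1%:M - w) *m pad t = pad t - w *m D *m t.
  by rewrite mulmxBl mul1mx wpad.
have sN : s *m (pad t - w *m D *m t) = p *m D *m t + s - p.
  rewrite mulmxBr /pad mulmxDr !mulmxA sw !mul0mx subr0 mulmxBr mulmx1 st.
  by rewrite addrA.
have E2 : pad s *m (pad t - w *m D *m t) =
    s *m D *m t + s *m D *m s - s *m D *m p + pad t - w *m D *m t
     - p *m D *m t - s + p.
  rewrite {1}/pad mulmxDl -(mulmxA (s *m D)) (mulmxBl 1%:M s) mul1mx sN.
  rewrite mulmxBr mulmxDr !mulmxA -sDt.
  set a := s *m D *m t; set b := s *m D *m s; set c := s *m D *m p.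
  set d := pad t; set f := w *m D *m t; set g := p *m D *m t.
  by apply/matrixP=> i j; rewrite !mxE; ring.
rewrite E1 E2 mulmxDl mul1mx.
have E3 : w *m (s *m D *m t + s *m D *m s - s *m D *m p + pad t - w *m D *m t
     - p *m D *m t - s + p) = w *m D *m t + w *m D *m s - w *m D *m p.
  clear E1 sN E2; move: (pad t) wpad => dd wdd.
  rewrite !(mulmxDr, mulmxN) !mulmxA ws wp wdd ww !mul0mx.
  set a := w *m D *m t; set b := w *m D *m s; set c := w *m D *m p.
  by apply/matrixP=> i j; rewrite !mxE; ring.
rewrite E3 wDs wDp /pad !(mulmxDr, mulmxDl, mulmxN, mulNmx) pDp.
set a := s *m D *m t; set b := s *m D *m s; set c := s *m D *m p.
set d := t *m D *m t; set f := w *m D *m t; set g := p *m D *m t.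
set h := p *m D *m s; set k := t *m D *m s; set l := t *m D *m p.
by apply/matrixP=> i j; rewrite !mxE; ring.
Qed.


(** Exchanging the factors by Sylvester's identity brings [p] next to [t - p], and their product is
    zero. *)
Let detw (x : 'M[R]_m) : \det (1%:M + (t - p) *m x *m p) = 1.
Proof. by rewrite det_mulmxC_add1 mulmxA ptp mul0mx addr0 det1. Qed.

Let det1w : \det (1%:M + w) = 1. Proof. by rewrite w_def detw. Qed.
Let det1Nw : \det (1%:M - w) = 1.
Proof. by rewrite w_def -mulNmx -mulmxN detw. Qed.

Lemma glue_det : \det (pad (s + t - p)) = \det (pad s) * \det (pad t).
Proof. by rewrite glue_pad_factor !det_mulmx det1w det1Nw !mul1r. Qed.

(** By anti-multiplicativity the left side is [b *m (1%:M + w) *m a *m (1%:M - w)], where [a] and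
    [b] are the adjugates of the padded halves; it remains to expand this product. *)
Lemma glue_adj : \adj (pad (s + t - p)) =
  \det (pad t) *: \adj (pad s) + \det (pad s) *: \adj (pad t)
  - (\det (pad s) * \det (pad t))%:M.
Proof.
have w1w : (1%:M - w) *m (1%:M + w) = 1%:M.
  by rewrite mulmxDr mulmx1 mulmxBl mul1mx ww subr0 subrK.
have w1w' : (1%:M + w) *m (1%:M - w) = 1%:M := mulmx1C w1w.
have adj1w : \adj (1%:M + w) = 1%:M - w.
  by rewrite -[LHS]mul1mx -{1}w1w -mulmxA mul_mx_adj det1w mulmx1.
have adj1Nw : \adj (1%:M - w) = 1%:M + w.
  by rewrite -[LHS]mul1mx -{1}w1w' -mulmxA mul_mx_adj det1Nw mulmx1.
rewrite glue_pad_factor !adj_mulmx adj1w adj1Nw.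
set a := \adj (pad s); set b := \adj (pad t).
set sg := \det (pad s); set ta := \det (pad t).
(* Each relation satisfied by a padded matrix becomes one for its adjugate, without inverting
   anything. *)
have adjE (A x y : 'M[R]_m) : A *m x = y -> \det A *: x = \adj A *m y.
  by move=> <-; rewrite mulmxA mul_adj_mx mul_scalar_mx.
have adjEl (A x y : 'M[R]_m) : x *m A = y -> \det A *: x = y *m \adj A.
  by move=> <-; rewrite -mulmxA mul_mx_adj mul_mx_scalar.
have aw : sg *: w = a *m w.
  by apply: adjE; rewrite /pad mulmxDl -mulmxA sw mulmx0 mulmxBl mul1mx sw subr0 add0r.
have bw : ta *: p = b *m (w + p).
  apply: adjE; rewrite /pad mulmxDl -mulmxA tp mulmxBl mul1mx tp subrr addr0.
  by rewrite w_def !mulmxBl pDp subrK.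
have bsp : ta *: (s - p) = b *m (s - p).
  by apply: adjE; rewrite /pad mulmxDl -mulmxA tsp mulmx0 mulmxBl mul1mx tsp subr0 add0r.
have bu : ta *: (1%:M - (s + t - p)) = b *m (1%:M - (s + t - p)).
  have tu : t *m (1%:M - (s + t - p)) = 0.
    by rewrite mulmxBr mulmx1 mulmxBr mulmxDr ts tt tp [p + t]addrC addrK subrr.
  by apply: adjE; rewrite /pad mulmxDl -mulmxA tu mulmx0 mulmxBl mul1mx tu subr0 add0r.
have bt : ta *: (1%:M - t) = b *m (1%:M - t).
  have tu : t *m (1%:M - t) = 0 by rewrite mulmxBr mulmx1 tt subrr.
  by apply: adjE; rewrite /pad mulmxDl -mulmxA tu mulmx0 mulmxBl mul1mx tu subr0 add0r.
have tpa : sg *: (t - p) = (t - p) *m a.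
  by apply: adjEl; rewrite /pad mulmxDr !mulmxA tps !mul0mx mulmxBr mulmx1 tps subr0 add0r.
have ua : sg *: (1%:M - (s + t - p)) = (1%:M - (s + t - p)) *m a.
  have us : (1%:M - (s + t - p)) *m s = 0.
    by rewrite mulmxBl mul1mx mulmxBl mulmxDl ss ts ps addrK subrr.
  by apply: adjEl; rewrite /pad mulmxDr !mulmxA us !mul0mx mulmxBr mulmx1 us subr0 add0r.
have sa : sg *: (1%:M - s) = (1%:M - s) *m a.
  have us : (1%:M - s) *m s = 0 by rewrite mulmxBl mul1mx ss subrr.
  by apply: adjEl; rewrite /pad mulmxDr !mulmxA us !mul0mx mulmxBr mulmx1 us subr0 add0r.
(* The identity is split as [(s - p) + p + (t - p) + (1%:M - (s + t - p))]. All pieces but [p] are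
   absorbed by [a] or [b] as scalars, and [b *m p *m a] later cancels against [b *m w *m a]. *)
have ba : b *m a = ta *: ((s - p) *m a) + b *m p *m a + sg *: (b *m (t - p))
                   + (sg * ta) *: (1%:M - (s + t - p)).
  rewrite (scalemxAl ta) bsp (scalemxAr sg) tpa [sg * ta]mulrC -scalerA ua.
  rewrite (scalemxAl ta) bu (mulmxA b (t - p)) -!mulmxDl -!mulmxDr.
  by congr (_ *m _); rewrite -{1}[b]mulmx1; congr (_ *m _);
     apply/matrixP=> i j; rewrite !mxE; ring.
have {}bw : b *m w = ta *: p - b *m p by rewrite bw mulmxDr addrK.
have {}sa : s *m a = a - sg *: (1%:M - s) by rewrite sa mulmxBl mul1mx subKr.
have {}bt : b *m t = b - ta *: (1%:M - t) by rewrite bt mulmxBr mulmx1 subKr.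
rewrite -(mulmxA _ a) (mulmxBr a) mulmx1 -aw (mulmxDr b) mulmx1 bw mulmxBr -scalemxAr.
rewrite !(mulmxDl _ _ w) mulNmx -scalemxAl -(mulmxA b p) pw scaler0 mulmx0 bw.
rewrite !(mulmxDl _ _ a) mulNmx -scalemxAl ba mulmxBl mulmxBr sa bt.
set x := b *m p; set y := p *m a; set z := x *m a.
by apply/matrixP=> i j; rewrite !mxE; case: (i == j); rewrite /= ?mulr1n ?mulr0n; ring.
Qed.
End Glue.
End Padding.

(** * Determinants, cofactor sums and inverses through padding *)

Section Selection.
Variables (R : comPzRingType) (m : nat).
Implicit Types (A D : 'M[R]_m) (S T : {set 'I_m}).
Local Notation restr_id := (@restr_id R m).

Definition selmx S : 'M[R]_(#|S|, m) := rowsub enum_val 1%:M.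

Lemma principal_submxE S A :
  principal_submx S A = selmx S *m A *m (selmx S)^T.
Proof.
rewrite /principal_submx mxsubcr [rowsub _ _]rowsubE /selmx trmx_mxsub trmx1.
by rewrite mulmx_colsub mulmx1.
Qed.

Lemma selmxE S a i : selmx S a i = (enum_val a == i)%:R.
Proof. by rewrite !mxE. Qed.

Lemma placeE S (A : 'M[R]_#|S|) : place A = (selmx S)^T *m A *m selmx S.
Proof.
apply/matrixP=> i j; rewrite /place summxE -mulmxA mxE; apply: eq_bigr => a _.
rewrite summxE [(selmx S)^T _ _]mxE selmxE mxE big_distrr /=.
apply: eq_bigr => b _; rewrite selmxE !mxE ![_ == enum_val _]eq_sym.
by rewrite -mulnb natrM [RHS]mulrCA.
Qed.

Lemma selmx_tr S : selmx S *m (selmx S)^T = 1%:M.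
Proof.
rewrite -{1}[selmx S]mulmx1 -principal_submxE; apply/matrixP=> a b.
by rewrite !mxE (inj_eq enum_val_inj).
Qed.

Lemma tr_selmx S : (selmx S)^T *m selmx S = restr_id S.
Proof.
apply/matrixP=> i j; rewrite restr_idE mxE.
under eq_bigr do rewrite mxE !selmxE.
have [iS|iNS] := boolP (i \in S); last first.
  rewrite andbF big1 // => a _; case: eqP => [ai|_]; last by rewrite mul0r.
  by rewrite -ai enum_valP in iNS.
rewrite (bigD1 (enum_rank_in iS i)) //= enum_rankK_in // eqxx mul1r andbT.
rewrite big1 ?addr0 // => a /eqP ne_a; case: eqP => [ai|_]; last by rewrite mul0r.
by case: ne_a; rewrite -[X in enum_rank_in _ X]ai enum_valK_in.
Qed.

Lemma place1 S : place (1%:M : 'M[R]_#|S|) = restr_id S.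
Proof. by rewrite placeE mulmx1 tr_selmx. Qed.

(** [padmx S A] is the identity plus a product that factors through dimension [#|S|], so Sylvester's
    identity moves the determinant to that size. *)
Lemma det_padmx S A : \det (padmx S A) = \det (principal_submx S A).
Proof.
have -> : padmx S A =
    1%:M + (selmx S)^T *m ((principal_submx S A - 1%:M) *m selmx S).
  rewrite mulmxBl mul1mx mulmxBr tr_selmx principal_submxE !mulmxA tr_selmx.
  by rewrite -(mulmxA _ (selmx S)^T) tr_selmx /padmx addrCA.
by rewrite det_mulmxC_add1 -mulmxA selmx_tr mulmx1 addrC subrK.
Qed.

Definition mxsum p (A : 'M[R]_p) : R := \sum_i \sum_j A i j.

Lemma mxsumE p (A : 'M[R]_p) :
  mxsum A = ((const_mx 1 : 'rV_p) *m A *m (const_mx 1 : 'cV_p)) 0 0.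
Proof.
rewrite mxE /mxsum exchange_big; apply: eq_bigr => j _.
by rewrite !mxE mulr1; apply: eq_bigr => i _; rewrite mxE mul1r.
Qed.

Lemma mxsumD p (A B : 'M[R]_p) : mxsum (A + B) = mxsum A + mxsum B.
Proof. by rewrite !mxsumE mulmxDr mulmxDl mxE. Qed.

Lemma mxsumZ p c (A : 'M[R]_p) : mxsum (c *: A) = c * mxsum A.
Proof. by rewrite !mxsumE -scalemxAr -scalemxAl mxE. Qed.

Lemma mxsum_sum p (I : Type) (r : seq I) (P : pred I) (F : I -> 'M[R]_p) :
  mxsum (\sum_(i <- r | P i) F i) = \sum_(i <- r | P i) mxsum (F i).
Proof.
apply: (big_morph _ (@mxsumD p)).
by rewrite -(scale0r (0 : 'M[R]_p)) mxsumZ mul0r.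
Qed.

Lemma mxsum_restr_id S : mxsum (restr_id S) = #|S|%:R.
Proof.
rewrite -sum1_card natr_sum big_mkcond /mxsum; apply: eq_bigr => i _.
rewrite (bigD1 i) //= restr_idE eqxx big1 ?addr0; first by case: (i \in S).
by move=> j; rewrite restr_idE eq_sym => /negbTE ->.
Qed.

Lemma cofE p (A : 'M[R]_p) : cof A = mxsum (\adj A).
Proof.
by rewrite /cof exchange_big; do 2![apply: eq_bigr => ? _]; rewrite mxE.
Qed.

(** The all-ones matrix is a column times a row, so the matrix determinant lemma applies. *)
Lemma cof_det p (A : 'M[R]_p) : cof A = \det (A + const_mx 1) - \det A.
Proof.
have -> : const_mx 1 = (const_mx 1 : 'cV[R]_p) *m (const_mx 1 : 'rV_p).
  by apply/matrixP=> i j; rewrite [RHS]mxE big_ord1 !mxE mulr1.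
by rewrite det_rank1_update addrC addKr cofE mxsumE.
Qed.

Lemma restr_id_idem S : restr_id S *m restr_id S = restr_id S.
Proof. by rewrite mul_restr_id setIid. Qed.

(** Outside [S] the padded matrix is the identity, so its adjugate is there the determinant times
    the identity. *)
Lemma restr_adj_padmx S A : restr_id S *m \adj (padmx S A) *m restr_id S =
  \adj (padmx S A) - \det (padmx S A) *: (1%:M - restr_id S).
Proof.
set M := padmx S A; set e := restr_id S.
have e0 : e *m (1%:M - e) = 0 by rewrite mulmxBr mulmx1 restr_id_idem subrr.
have e0' : (1%:M - e) *m e = 0 by rewrite mulmxBl mul1mx restr_id_idem subrr.
have adj_e : \adj M *m (1%:M - e) = \det M *: (1%:M - e).
  rewrite -mul_scalar_mx -mul_adj_mx -mulmxA; congr (_ *m _).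
  rewrite /M /padmx -/e mulmxDl -(mulmxA _ e) e0 mulmx0 add0r mulmxBl mul1mx.
  by rewrite e0 subr0.
have e_adj : (1%:M - e) *m \adj M = \det M *: (1%:M - e).
  rewrite -mul_mx_scalar -mul_mx_adj mulmxA; congr (_ *m _).
  rewrite /M /padmx -/e mulmxDr !mulmxA e0' !mul0mx add0r mulmxBr mulmx1.
  by rewrite e0' subr0.
have -> : e *m \adj M = \adj M - (1%:M - e) *m \adj M.
  by rewrite mulmxBl mul1mx subKr.
rewrite e_adj mulmxBl -scalemxAl e0' scaler0 subr0.
by rewrite -adj_e mulmxBr mulmx1 subKr.
Qed.

(** Adding the all-ones matrix to [A] changes the padded matrix by a column times a row, so
    [cof_det] can be evaluated at full size. The correction removes the [m - #|S|] diagonal entries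
    of the padded adjugate outside [S], each equal to the determinant. *)
Lemma cof_principal_submx S A :
  cof (principal_submx S A) = mxsum (\adj (padmx S A))
    - \det (principal_submx S A) * (m%:R - #|S|%:R).
Proof.
rewrite cof_det.
have -> : principal_submx S A + const_mx 1 = principal_submx S (A + const_mx 1).
  by apply/matrixP=> i j; rewrite !mxE.
pose e := restr_id S.
have padJ : padmx S (A + const_mx 1) =
    padmx S A + (e *m (const_mx 1 : 'cV_m)) *m ((const_mx 1 : 'rV_m) *m e).
  rewrite /padmx mulmxDr mulmxDl addrAC; congr (_ + _ + _).
  rewrite mulmxA -(mulmxA e); congr (_ *m _ *m _).
  by apply/matrixP=> i j; rewrite !mxE big_ord1 !mxE mulr1.
rewrite -det_padmx padJ det_rank1_update -det_padmx addrC addKr.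
have -> : const_mx 1 *m e *m \adj (padmx S A) *m (e *m const_mx 1) =
    (const_mx 1 : 'rV_m) *m (e *m \adj (padmx S A) *m e) *m (const_mx 1 : 'cV_m).
  by rewrite !mulmxA.
rewrite -mxsumE restr_adj_padmx.
rewrite -scaleNr mxsumD mxsumZ mulNr -scaleN1r mxsumD mxsumZ mxsum_restr_id mulN1r.
by rewrite -restr_idT mxsum_restr_id cardsT card_ord.
Qed.

(** Both [place N + (1%:M - restr_id S)] and [\det N *: \adj (padmx S A)] are inverse to
    [padmx S A]. *)
Lemma place_inverse S A (N : 'M[R]_#|S|) :
  is_inverse_mx (principal_submx S A) N ->
  place N = \det N *: \adj (padmx S A) - (1%:M - restr_id S).
Proof.
case=> AN _; set e := restr_id S.
have e_pl : e *m place N = place N.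
  by rewrite /e placeE -tr_selmx !mulmxA -(mulmxA _ (selmx S)) selmx_tr mulmx1.
have eApl : e *m A *m e *m place N = e.
  rewrite /e placeE -tr_selmx !mulmxA -(mulmxA _ (selmx S)) selmx_tr mulmx1.
  rewrite -3!(mulmxA (selmx S)^T) -principal_submxE.
  by rewrite AN mulmx1.
have padN : padmx S A *m (place N + (1%:M - e)) = 1%:M.
  have eAe0 : e *m A *m e *m (1%:M - e) = 0.
    by rewrite -(mulmxA _ e) mulmxBr mulmx1 restr_id_idem subrr mulmx0.
  have cpl0 : (1%:M - e) *m place N = 0 by rewrite mulmxBl mul1mx e_pl subrr.
  have cc : (1%:M - e) *m (1%:M - e) = 1%:M - e.
    by rewrite {1}mulmxBr mulmx1 mulmxBl mul1mx restr_id_idem subrr subr0.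
  rewrite /padmx -/e (mulmxDl (e *m A *m e)) (mulmxDr (e *m A *m e)).
  by rewrite (mulmxDr (1%:M - e)) eApl eAe0 cpl0 cc addr0 add0r addrC subrK.
apply/eqP; rewrite eq_sym subr_eq; apply/eqP.
rewrite -[LHS]mulmx1 -{1}padN mulmxA -scalemxAl mul_adj_mx det_padmx.
by rewrite scale_scalar_mx mulrC -det_mulmx AN det1 mul1mx.
Qed.

Lemma padmxT A : padmx setT A = A.
Proof. by rewrite /padmx restr_idT mul1mx mulmx1 subrr addr0. Qed.
End Selection.

(** * Gluing two index sets *)

Section GlueSets.
Variables (R : comPzRingType) (m : nat) (D : 'M[R]_m) (S T : {set 'I_m}).
Local Notation restr_id := (@restr_id R m).
Let P := S :&: T.
Hypothesis id_P : restr_id P *m D *m restr_id P = restr_id P.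
Hypothesis sepST : restr_id S *m D *m restr_id T =
  restr_id S *m D *m restr_id P *m D *m restr_id T.
Hypothesis sepTS : restr_id T *m D *m restr_id S =
  restr_id T *m D *m restr_id P *m D *m restr_id S.

Let TS : restr_id T *m restr_id S = restr_id P.
Proof. by rewrite mul_restr_id setIC. Qed.

Lemma det_padmxU : \det (padmx (S :|: T) D) = \det (padmx S D) * \det (padmx T D).
Proof.
rewrite {1}/padmx restr_idU.
exact: (glue_det (restr_id_idem _ _) (restr_id_idem _ _) (mul_restr_id _ _ _) TS
  id_P sepST sepTS erefl).
Qed.

Lemma adj_padmxU : \adj (padmx (S :|: T) D) =
  \det (padmx T D) *: \adj (padmx S D) + \det (padmx S D) *: \adj (padmx T D)
  - (\det (padmx S D) * \det (padmx T D))%:M.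
Proof.
rewrite {1}/padmx restr_idU.
exact: (glue_adj (restr_id_idem _ _) (restr_id_idem _ _) (mul_restr_id _ _ _) TS
  id_P sepST sepTS erefl).
Qed.
End GlueSets.

(** * Product distance matrices *)

Section Underlying.
Variables (n : nat) (e : rel 'I_n).

Lemma adj_underlying x y : e x y -> x != y -> adj (underlying e) x y.
Proof.
move=> exy nxy; apply/imsetP; exists (x, y) => //=.
by rewrite inE /= nxy.
Qed.

Lemma underlying_loopless x : ~~ adj (underlying e) x x.
Proof.
apply/imsetP=> -[[a b]]; rewrite inE /= setUid => /andP[nab _] /setP eqab.
have := eqab a; have := eqab b; rewrite !inE !eqxx orbT.
by move=> /eqP bx /eqP ax; rewrite ax bx eqxx in nab.
Qed.

Lemma underlying_connected : strongly_connected e ->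
  forall x y, connect (adj (underlying e)) x y.
Proof.
move=> sc_e x y; apply: connect_sub (sc_e x y) => a b eab.
have [->|nab] := eqVneq a b; first exact: connect0.
exact/connect1/adj_underlying.
Qed.

(** A simple path uses no loops of [e], and these are the only arcs missing from the underlying
    graph. *)
Lemma uniq_path_underlying x p :
  path e x p -> uniq (x :: p) -> path (adj (underlying e)) x p.
Proof.
elim: p x => //= y p IHp x /andP[xy yp] /andP[]; rewrite inE negb_or.
by case/andP=> nxy _ up; rewrite adj_underlying //= IHp.
Qed.

Lemma separates_all_paths_through v (A B : {set 'I_n}) i j :
  separates (underlying e) v A B -> i \in A -> j \in B ->
  all_paths_through e i j v.
Proof.
move=> sepAB iA jB p ep up lp; apply: (sepAB i p) => //; last by rewrite lp.
exact: uniq_path_underlying.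
Qed.
End Underlying.

Section DistanceMatrix.
Variables (R : comPzRingType) (n : nat) (k : 'I_n -> nat).
Variable eta : forall i j : 'I_n, 'M[R]_(k i, k j).
Local Notation K := (\sum_v k v)%N.
Local Notation D := (distance_mx eta).
Local Notation N := (node_indices k).
Local Notation e_ W := (@restr_id R K (N W)).
Implicit Types (W : {set 'I_n}) (v : 'I_n).

Lemma distance_mxE i j (a : 'I_(k i)) (b : 'I_(k j)) :
  D (tagnat.Rank i a) (tagnat.Rank j b) = eta i j a b.
Proof. by have /matrixP/(_ a b) := mxblockK eta i j; rewrite mxE. Qed.

Lemma node_indices1 v : N [set v] = [set tagnat.Rank v c | c : 'I_(k v)].
Proof.
apply/setP=> a; rewrite !inE; apply/eqP/imsetP=> [<-|[c _ ->]].
  by exists (tagnat.sig2 a); rewrite ?tagnat.sig2K.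
exact: tagnat.Rank1K.
Qed.

Lemma Rank_inj v : injective (@tagnat.Rank n k v).
Proof.
by move=> a b /tagnat.rank_inj/eqP; rewrite eq_Tagged /= => /eqP.
Qed.

Lemma card_node_indices1 v : #|N [set v]| = k v.
Proof. by rewrite node_indices1 card_imset ?card_ord //; apply: Rank_inj. Qed.

(** The factorization of [eta] through [v], written with the idempotents that the gluing lemmas
    expect. *)
Lemma distance_mx_separated v W1 W2 :
    {in W1 & W2, forall i j, eta i j = eta i v *m eta v j} ->
  e_ W1 *m D *m e_ W2 = e_ W1 *m D *m e_ [set v] *m D *m e_ W2.
Proof.
move=> eta_sep; apply/matrixP=> i j; rewrite !mul_mx_restr_idE.
have [jW2|_] := boolP (j \in N W2); last by rewrite !mulr0.
rewrite !mulr1 -!mulmxA !mul_restr_idE.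
have [iW1|_] := boolP (i \in N W1); last by rewrite !mul0r.
rewrite !mul1r.
have -> : (D *m (e_ [set v] *m D)) i j = \sum_(l in N [set v]) D i l * D l j.
  rewrite [LHS]mxE [RHS]big_mkcond; apply: eq_bigr => l _; rewrite mul_restr_idE.
  by case: (l \in _); rewrite ?mul1r // mul0r mulr0.
rewrite node_indices1 big_imset /=; last by move=> ? ? _ _; apply: Rank_inj.
rewrite -(tagnat.sig2K i) -(tagnat.sig2K j) distance_mxE.
rewrite eta_sep; last 2 first; [by move: iW1; rewrite inE | by move: jW2; rewrite inE|].
by rewrite [LHS]mxE; apply: eq_big => c; rewrite ?inE // !distance_mxE.
Qed.

Lemma distance_mx_id v : eta v v = 1%:M ->
  e_ [set v] *m D *m e_ [set v] = e_ [set v].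
Proof.
move=> eta1; apply/matrixP=> i j; rewrite mul_mx_restr_idE mul_restr_idE restr_idE.
have [iv|] := boolP (i \in N [set v]); last by rewrite andbF mul0r mul0r.
have [jv|jNv] := boolP (j \in N [set v]); last first.
  by rewrite mulr0 andbT; case: eqP jNv => // <-; rewrite iv.
rewrite mul1r mulr1 andbT; move: iv jv; rewrite node_indices1.
case/imsetP=> a _ -> /imsetP[b _ ->]; rewrite distance_mxE eta1 mxE.
by rewrite (inj_eq (@Rank_inj v)).
Qed.

Lemma node_indicesU W1 W2 : N (W1 :|: W2) = N W1 :|: N W2.
Proof. by apply/setP=> a; rewrite !inE. Qed.

Lemma node_indicesI W1 W2 : N (W1 :&: W2) = N W1 :&: N W2.
Proof. by apply/setP=> a; rewrite !inE. Qed.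

Lemma node_indicesT : N setT = setT.
Proof. by apply/setP=> a; rewrite !inE. Qed.

Lemma restr_id_node_indices W : e_ W = \sum_(v in W) e_ [set v].
Proof.
apply/matrixP=> i j; rewrite summxE restr_idE inE.
transitivity (\sum_(v in W) ((i == j) && (tagnat.sig1 i == v))%:R : R); last first.
  by apply: eq_bigr => v _; rewrite restr_idE !inE.
case: (i == j); last by rewrite [RHS]big1.
rewrite /= [RHS]big_mkcond [RHS](bigD1 (tagnat.sig1 i)) //= eqxx.
rewrite [X in _ = _ + X]big1 ?addr0; first by case: ifP.
by move=> v; rewrite eq_sym => /negbTE->; case: ifP.
Qed.
End DistanceMatrix.


Lemma big_disjointU_cond (U : Type) (idx : U) (op : Monoid.com_law idx) (I : finType)
    (b1 b2 : {set I}) (P : pred I) (F : I -> U) : [disjoint b1 & b2] ->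
  \big[op/idx]_(i in b1 :|: b2 | P i) F i =
    op (\big[op/idx]_(i in b1 | P i) F i) (\big[op/idx]_(i in b2 | P i) F i).
Proof.
move=> d12; rewrite (bigID (mem b1)) /=; congr (op _ _); apply: eq_bigl => i.
  by rewrite inE; case: (i \in b1); case: (i \in b2); case: (P i).
rewrite inE; case i1: (i \in b1) => /=; last by rewrite andbT.
by rewrite (disjointFr d12 i1) andbF.
Qed.

Lemma big_disjointU (U : Type) (idx : U) (op : Monoid.com_law idx) (I : finType)
    (b1 b2 : {set I}) (F : I -> U) : [disjoint b1 & b2] ->
  \big[op/idx]_(i in b1 :|: b2) F i =
    op (\big[op/idx]_(i in b1) F i) (\big[op/idx]_(i in b2) F i).
Proof.
move=> d12; have := big_disjointU_cond op xpredT F d12.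
by rewrite !big_mkcondr.
Qed.

(** * The product rule over a set of indices *)

Section Leibniz.
Variables (R : comPzRingType) (V : lmodType R) (I : finType).
Variables (f : I -> R) (g : I -> V).
Implicit Types b : {set I}.

(** The derivative of the product of the [f i] when [g i] plays the part of the derivative of
    [f i]. *)
Definition leibniz_sum b := \sum_(i in b) (\prod_(j in b | j != i) f j) *: g i.

Lemma leibniz_sumU b1 b2 : [disjoint b1 & b2] ->
  leibniz_sum (b1 :|: b2) = (\prod_(i in b2) f i) *: leibniz_sum b1
                          + (\prod_(i in b1) f i) *: leibniz_sum b2.
Proof.
(* For [i] in [c1] no index in the disjoint set [c2] equals [i], so the whole product over [c2]
   factors out. *)
have half (c1 c2 : {set I}) : [disjoint c1 & c2] ->
    \sum_(i in c1) (\prod_(j in c1 :|: c2 | j != i) f j) *: g i =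
    (\prod_(i in c2) f i) *: leibniz_sum c1.
  move=> d12; rewrite scaler_sumr; apply: eq_bigr => i i1.
  rewrite big_disjointU_cond //= scalerA mulrC; congr (_ * _ *: _).
  apply: eq_bigl => j; case: eqVneq => [->|_]; last by rewrite andbT.
  by rewrite (disjointFr d12 i1).
move=> d12; rewrite {1}/leibniz_sum.
rewrite big_disjointU //= half // [X in _ + X = _](_ : _ = \sum_(i in b2)
  (\prod_(j in b2 :|: b1 | j != i) f j) *: g i); last by rewrite setUC.
by rewrite half // disjoint_sym.
Qed.
End Leibniz.

(** * Determinant, cofactor sum, quotients and inverse *)

Section ProductDistance.
Variables (R : comPzRingType) (n : nat) (e : rel 'I_n) (k : 'I_n -> nat).
Variable eta : forall i j : 'I_n, 'M[R]_(k i, k j).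
Hypotheses (n_gt0 : (0 < n)%N) (sc_e : strongly_connected e).
Hypothesis pd_eta : product_distance e eta.
Local Notation K := (\sum_v k v)%N.
Local Notation D := (distance_mx eta).
Local Notation D_ := (block_distance_mx eta).
Local Notation N := (node_indices k).
Local Notation e_ W := (@restr_id R K (N W)).
Local Notation blocks := (strong_blocks e).
Local Notation pad W := (padmx (N W) D).
Let d_ (B : ugraph 'I_n) : R := \det (D_ B).

Let strong_block_ind := block_ind (erefl : (underlying e).1 = setT)
  (underlying_connected sc_e) (@underlying_loopless _ e).

Let det_pad_block B : \det (pad B.1) = d_ B.
Proof. exact: det_padmx. Qed.

Let det_adj_glue v (W1 W2 : {set 'I_n}) : cut_vertex (underlying e) v ->
    W1 :&: W2 = [set v] -> separates (underlying e) v W1 W2 ->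
    separates (underlying e) v W2 W1 ->
  \det (pad (W1 :|: W2)) = \det (pad W1) * \det (pad W2) /\
  \adj (pad (W1 :|: W2)) = \det (pad W2) *: \adj (pad W1)
     + \det (pad W1) *: \adj (pad W2) - (\det (pad W1) * \det (pad W2))%:M.
Proof.
move=> cv W12 sep12 sep21; case: pd_eta => _ eta1 eta_sep.
have P12 : N W1 :&: N W2 = N [set v] by rewrite -node_indicesI W12.
have idP : e_ [set v] *m D *m e_ [set v] = e_ [set v].
  by apply: distance_mx_id; apply: eta1.
have s12 : e_ W1 *m D *m e_ W2 = e_ W1 *m D *m e_ [set v] *m D *m e_ W2.
  apply: distance_mx_separated => i j iW jW; apply: eta_sep => //.
  exact: separates_all_paths_through sep12 iW jW.
have s21 : e_ W2 *m D *m e_ W1 = e_ W2 *m D *m e_ [set v] *m D *m e_ W1.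
  apply: distance_mx_separated => i j iW jW; apply: eta_sep => //.
  exact: separates_all_paths_through sep21 iW jW.
rewrite node_indicesU -P12 in idP s12 s21 *.
by split; [apply: det_padmxU | apply: adj_padmxU].
Qed.

(** Both formulas are proved together by induction over blocks: gluing acts on adjugate minus
    determinant as a product rule whose coefficients are the determinants of the halves. *)
Lemma det_adj_distance_mx : \det D = \prod_(B in blocks) d_ B /\
  \adj D = (\det D)%:M
    + leibniz_sum d_ (fun B => \adj (pad B.1) - (d_ B)%:M) blocks.
Proof.
pose P W (b : {set ugraph 'I_n}) := \det (pad W) = \prod_(B in b) d_ B /\
  \adj (pad W) = (\det (pad W))%:M
    + leibniz_sum d_ (fun B => \adj (pad B.1) - (d_ B)%:M) b.
suff: P setT blocks by rewrite /P node_indicesT padmxT.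
apply: (strong_block_ind (P := P)); last exact: Ordinal n_gt0.
  move=> B _; rewrite /P /leibniz_sum det_pad_block !big_set1; split=> //.
  have -> : \prod_(C in [set B] | C != B) d_ C = 1.
    by apply: big1 => C /andP[/set1P->]; rewrite eqxx.
  by rewrite scale1r addrC subrK.
move=> v W1 W2 b1 b2 cv W12 sep12 sep21 d12 [det1 adj1] [det2 adj2].
have [detU adjU] := det_adj_glue cv W12 sep12 sep21.
rewrite /P adjU detU leibniz_sumU // -det1 -det2; split.
  by rewrite big_disjointU //= det1 det2.
rewrite {1}adj1 {1}adj2 !scalerDr !scale_scalar_mx.
set x := _ *: leibniz_sum _ _ b1; set y := _ *: leibniz_sum _ _ b2.
by apply/matrixP=> i j; rewrite !mxE; case: (i == j); rewrite /= ?mulr1n ?mulr0n; ring.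
Qed.

(** Double counting of the pairs of a block and a node in it. *)
Lemma sum_num_blocks_at (V : lmodType R) (x : 'I_n -> V) :
  \sum_(v < n) ((num_blocks_at e v)%:R - 1) *: x v =
  \sum_(B in blocks) \sum_(v in B.1) x v - \sum_(v < n) x v.
Proof.
under eq_bigr => v _ do rewrite scalerBl scale1r.
rewrite sumrB; congr (_ - _).
under [RHS]eq_bigr => B _ do rewrite big_mkcond.
rewrite exchange_big; apply: eq_bigr => v _.
rewrite -big_mkcondr /= /num_blocks_at -sum1_card natr_sum scaler_suml.
by apply: eq_big => [B|B _]; rewrite ?inE ?scale1r.
Qed.

Lemma sum_restr_id_blocks :
  \sum_(v < n) ((num_blocks_at e v)%:R - 1) *: e_ [set v] =
  \sum_(B in blocks) e_ B.1 - 1%:M.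
Proof.
rewrite sum_num_blocks_at; congr (_ - _).
  by apply: eq_bigr => B _; rewrite -restr_id_node_indices.
rewrite -restr_idT -(node_indicesT k) restr_id_node_indices.
by apply: eq_bigl => v; rewrite inE.
Qed.

Lemma sum_card_blocks :
  \sum_(v < n) (k v)%:R * ((num_blocks_at e v)%:R - 1) =
  \sum_(B in blocks) #|N B.1|%:R - K%:R :> R.
Proof.
have := congr1 (@mxsum R K) sum_restr_id_blocks.
rewrite -scaleN1r mxsumD mxsumZ mulN1r !mxsum_sum.
rewrite -(restr_idT R K) mxsum_restr_id cardsT card_ord.
have -> : \sum_(B in blocks) mxsum (e_ B.1) = \sum_(B in blocks) #|N B.1|%:R.
  by apply: eq_bigr => B _; rewrite mxsum_restr_id.
move=> <-; apply: eq_bigr => v _.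
by rewrite mxsumZ mxsum_restr_id card_node_indices1 mulrC.
Qed.


(** Two sets glued at a cut-vertex share [k0] rows, so [#|N W| - k0] is additive along the block
    decomposition. *)
Lemma sum_card_blocks_const k0 :
    (forall v, cut_vertex (underlying e) v -> k v = k0) ->
  K%:R - k0%:R = \sum_(B in blocks) (#|N B.1|%:R - k0%:R) :> R.
Proof.
move=> k_cut.
pose P W (b : {set ugraph 'I_n}) := #|N W|%:R - k0%:R = \sum_(B in b) (#|N B.1|%:R - k0%:R) :> R.
suff: P setT blocks by rewrite /P node_indicesT cardsT card_ord.
apply: (strong_block_ind (P := P)); last exact: Ordinal n_gt0.
  by move=> B _; rewrite /P big_set1.
move=> v W1 W2 b1 b2 cv W12 _ _ d12 P1 P2; rewrite /P.
rewrite big_disjointU //= -P1 -P2.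
have := cardsUI (N W1) (N W2).
rewrite -node_indicesI W12 card_node_indices1 (k_cut v cv) -node_indicesU.
move/(congr1 (fun x => x%:R : R)); rewrite !natrD => /(canRL (addrK _)) ->.
by rewrite addrACA addrA.
Qed.

Lemma mul_prod_neq (f : ugraph 'I_n -> R) B : B \in blocks ->
  f B * \prod_(C in blocks | C != B) f C = \prod_(C in blocks) f C.
Proof. by move=> Bb; rewrite [RHS](bigD1 B). Qed.

(** The entries of the adjugate formula are summed; [cof_principal_submx] converts the padded
    adjugate of each block, and [sum_card_blocks] matches the remaining multiples of [\det D]. *)
Lemma cof_distance_mx : cof D = \sum_(B in blocks)
    cof (D_ B) * \prod_(C in blocks | C != B) d_ C
  - \det D * \sum_(v < n) (k v)%:R * ((num_blocks_at e v)%:R - 1).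
Proof.
have [detD adjD] := det_adj_distance_mx.
have mxsum_scalar c : mxsum (c%:M : 'M[R]_K) = c * K%:R.
  by rewrite -[c]mulr1 -scale_scalar_mx mxsumZ -restr_idT mxsum_restr_id cardsT
    card_ord mulr1.
rewrite cofE adjD mxsumD /leibniz_sum mxsum_sum.
rewrite mxsum_scalar sum_card_blocks mulrBr opprB [in RHS]addrCA; congr (_ + _).
rewrite mulr_sumr -sumrB; apply: eq_bigr => B Bb.
rewrite mxsumZ -scaleN1r mxsumD mxsumZ mxsum_scalar mulN1r.
rewrite [cof _]cof_principal_submx -/(D_ B) -/(d_ B).
rewrite detD -(mul_prod_neq d_ Bb); ring.
Qed.

Lemma quotient_distance_mx k0 : invertible_mx D ->
    (forall v, cut_vertex (underlying e) v -> k v = k0) ->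
  exists (q : R) (q_ : ugraph 'I_n -> R),
    [/\ is_quotient (cof D) (\det D) q,
        forall B, B \in blocks -> is_quotient (cof (D_ B)) (d_ B) (q_ B)
      & q - k0%:R = \sum_(B in blocks) (q_ B - k0%:R)].
Proof.
case=> E [DE _] k_cut; pose c := \det E.
have Dc : \det D * c = 1 by rewrite -det_mulmx DE det1.
have [detD _] := det_adj_distance_mx.
(* Since [\det D] is the product of the block determinants, this is an inverse of [d_ B] for every
   strong block [B]. *)
pose c_ B := c * \prod_(C in blocks | C != B) d_ C.
exists (cof D * c), (fun B => cof (D_ B) * c_ B); split; first by exists c.
  by move=> B Bb; exists (c_ B); rewrite // /c_ mulrCA mul_prod_neq // -detD mulrC.
rewrite cof_distance_mx mulrBl [_ * _ * c]mulrAC Dc mul1r sum_card_blocks opprB.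
rewrite addrA addrAC -[_ + K%:R - _]addrA -addrA (sum_card_blocks_const k_cut).
rewrite mulr_suml -sumrN -!big_split /=; apply: eq_bigr => B _.
by rewrite addKr -mulrA [_ * c]mulrC.
Qed.

(** With [c] inverse to [\det D], the candidate is [c *: \adj D]: each term of the adjugate formula,
    multiplied by [c], is a placed inverse minus the idempotent of its block, and
    [sum_restr_id_blocks] turns these idempotents into the correction term. *)
Lemma inverse_distance_mx
    (Dinv_ : forall B : ugraph 'I_n, 'M[R]_#|N B.1|) :
    (forall B, B \in blocks -> is_inverse_mx (D_ B) (Dinv_ B)) ->
  is_inverse_mx D
    (\sum_(B in blocks) place (Dinv_ B)
     - \sum_(v < n) ((num_blocks_at e v)%:R - 1) *:
         place (1%:M : 'M[R]_#|N [set v]|)).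
Proof.
move=> inv_; have [detD adjD] := det_adj_distance_mx.
set X := (X in is_inverse_mx _ X); suff DX : D *m X = 1%:M.
  by split=> //; apply: mulmx1C.
pose f B := \det (Dinv_ B); pose c := \prod_(B in blocks) f B.
have df B : B \in blocks -> d_ B * f B = 1.
  by move=> /inv_[DB _]; rewrite -det_mulmx DB det1.
have Dc : c * \det D = 1.
  by rewrite detD mulrC -big_split; apply: big1 => B /df.
suff -> : X = c *: \adj D by rewrite -scalemxAr mul_mx_adj scale_scalar_mx Dc.
rewrite adjD scalerDr scale_scalar_mx Dc /X.
have -> : \sum_(v < n) ((num_blocks_at e v)%:R - 1) *:
      place (1%:M : 'M[R]_#|N [set v]|) = \sum_(B in blocks) e_ B.1 - 1%:M.
  by rewrite -sum_restr_id_blocks; apply: eq_bigr => v _; rewrite place1.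
rewrite opprB addrCA; congr (_ + _); rewrite -sumrB /leibniz_sum scaler_sumr.
apply: eq_bigr => B Bb; rewrite (place_inverse (inv_ B Bb)) scalerA.
have -> : c * \prod_(C in blocks | C != B) d_ C = f B.
  rewrite /c -(mul_prod_neq f Bb) -mulrA -big_split big1 ?mulr1 // => C.
  by case/andP=> Cb _; rewrite /= mulrC df.
rewrite scalerBr scale_scalar_mx [f B * _]mulrC df // /f.
by rewrite opprB addrA addrAC addrK.
Qed.
End ProductDistance.

Theorem theoremC (R : comPzRingType) (n : nat) (e : rel 'I_n)
    (k : 'I_n -> nat) (eta : forall i j : 'I_n, 'M[R]_(k i, k j))
    (n_gt0 : (0 < n)%N)
    (sc_e : strongly_connected e)
    (pd_eta : product_distance e eta) :
  let D := distance_mx eta in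
  let D_ := block_distance_mx eta in
  [/\ \det D = \prod_(B in strong_blocks e) \det (D_ B),
      cof D = \sum_(B in strong_blocks e)
                 cof (D_ B) * \prod_(C in strong_blocks e | C != B) \det (D_ C)
              - \det D * \sum_(v < n)
                  (k v)%:R * ((num_blocks_at e v)%:R - 1),
      forall k0 : nat,
        invertible_mx D ->
        (forall v, cut_vertex (underlying e) v -> k v = k0) ->
        exists (q : R) (q_ : ugraph 'I_n -> R),
          [/\ is_quotient (cof D) (\det D) q,
              forall B, B \in strong_blocks e ->
                is_quotient (cof (D_ B)) (\det (D_ B)) (q_ B)
            & q - k0%:R = \sum_(B in strong_blocks e) (q_ B - k0%:R)]
    & forall Dinv_ : forall B : ugraph 'I_n, 'M[R]_#|node_indices k B.1|,
        (forall B, B \in strong_blocks e -> is_inverse_mx (D_ B) (Dinv_ B)) ->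
        is_inverse_mx D
          (\sum_(B in strong_blocks e) place (Dinv_ B)
           - \sum_(v < n) ((num_blocks_at e v)%:R - 1) *:
               place (1%:M : 'M[R]_#|node_indices k [set v]|))].
Proof.
move=> D D_; split.
- by have [] := det_adj_distance_mx n_gt0 sc_e pd_eta.
- exact: cof_distance_mx.
- by move=> k0; apply: quotient_distance_mx.
- exact: inverse_distance_mx.
Qed.
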